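(* Let $\mathcal B$ be a subfactorizable fusion bialgebra with exchange relations, with a given forest fusion graph $\Gamma$ and quantum dimensions $d_0,\dots,d_n$. Then each fusion coefficient $N_{ij}^k$ is a sum of $d_s$'s with positive or negative signs, i.e. there are $\varepsilon_s\in\{-1,0,1\}$ (depending on $i,j,k$ and $\Gamma$) such that $N_{ij}^k=\sum_{s=0}^n\varepsilon_sd_s$.
   Context: Fusion bialgebra: a unital $*$-algebra over $\mathbb C$ with a linear basis $\{x_0=1,x_1,\dots,x_n\}$ with $x_jx_k=\sum_s\widetilde N_{j,k}^sx_s$, $\widetilde N_{j,k}^s\ge0$, and an involution $*$ on indices with $x_k^*=x_{k^*}$, $\widetilde N_{j,k}^0=\delta_{j,k^*}$. It is subfactorizable if it is realized as the 2-box space $\mathcal P_{2,+}$ (abelian) of an irreducible subfactor planar algebra $\mathcal P$, with convolution as product, $180^\circ$ rotation as involution on basis elements, and $x_j=\sqrt{\delta/d_j}\,p_j$, where $p_0,\dots,p_n$ are the minimal projections of $\mathcal P_{2,+}$, $p_0$ is the Jones projection, $\delta$ is the circle value, and the quantum dimension $d_i$ is defined by: closing the right strand of $p_i$ gives $d_i$ times a strand. The convolution $p_k*p_j=\sum_iN_{kj}^ip_i$ places $p_k$ to the left of $p_j$ and joins the right-hand points of $p_k$ with the left-hand points of $p_j$ (upper to upper, lower to lower); the $N_{kj}^i$ are the fusion coefficients. In $\mathcal P_{3,+}$, stacking left factors on top: $E_1(i,j)=(p_i\otimes1)(1\otimes\mathfrak F_s(p_j))$, $E_2(s,t)=(p_s\otimes1)U(p_t\otimes1)$,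 $E_3(\ell,m)=(1\otimes\mathfrak F_s(p_\ell))(p_m\otimes1)$; here $x\otimes1$ is $x$ with a through strand added on the right, $1\otimes\mathfrak F_s(x)$ is the $90^\circ$ counterclockwise rotation of $x$ on strands 2,3 with a through strand on the left, and $U$ is through strand 1 with the (unnormalized) cup-cap on strands 2,3. $\mathcal P$ is an exchange relation planar algebra if it is generated by $\mathcal P_2$ and each $E_1(i,j)$ is a linear combination of the $E_2(s,t)$ and $E_3(\ell,m)$; $\mathcal B$ has exchange relations if it is the 2-box space of an exchange relation planar algebra. The fusion graph $\Gamma=\{\Gamma_k:0\le k\le n\}$ consists of bipartite graphs $\Gamma_k$ with white vertices $0,\dots,n$ and black vertices $0,\dots,n$, with an edge between white $i$ and black $j$ iff $N_{kj}^i\ne0$. It is a forest fusion graph if every $\Gamma_k$ is acyclic. *)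

(* Defs.v *)
From HB Require Import structures.
From mathcomp Require Import all_boot all_order all_algebra all_field.
From mathcomp Require Import complex reals.

Set Implicit Arguments.
Unset Strict Implicit.
Unset Printing Implicit Defensive.
Import Order.TTheory GRing.Theory Num.Theory.
Local Open Scope ring_scope.

(* Connected components, as lists, of the graph on vs in which x is joined to
   the elements of nb x.  nb need not be symmetric as long as reachability is:
   for a permutation nb x = [:: s x], the components are the cycles of s. *)
Section Components.
Variables (T : eqType) (vs : seq T) (nb : T -> seq T).

Definition reach (x : T) : seq T :=
  iter (size vs) (fun s => undup (s ++ flatten (map nb s))) [:: x].

Definition components : seq (seq T) :=
  undup [seq (let r := reach x in [seq y <- vs | y \in r]) | x <- vs].
End Components.

(* ------------------------------------------------------------------------ *)
(* Shaded planar tangles, up to isotopy.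

   A colour (k, s) is that of a disc with 2k boundary points whose marked
   interval ($) lies in an unshaded (s = true, sign +) or a shaded (s = false,
   sign -) region.  The points of a disc are numbered clockwise 0, ..., 2k-1,
   starting after the marked interval.  For a box drawn as a rectangle with $ on
   its left, the top points are 0, ..., k-1 from left to right, and the bottom
   points are 2k-1, ..., k from left to right.

   The discs of a tangle are numbered: 0 is the outer disc, and 1, 2, ... are the
   inner ones.  The point (d, j) is the j-th point of the disc d.  An isotopy
   class of tangles is recorded by the involution telling which boundary points
   are joined by a string, together with the number of closed loops.  The
   relative position of different connected components is not recorded: the
   encoding is used only for subfactor planar algebras, where P_{0,+} and P_{0,-}
   are one-dimensional and the partition function is spherical, so that a
   component not meeting the outer disc contributes the same scalar in every
   region. *)
Definition color := (nat * bool)%type.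
Definition point := (nat * nat)%type.

Record tangle (outer : color) := Tangle {
  inner : seq color;
  string : point -> point;
  loops : nat
}.

Definition col (cs : seq color) (d : nat) : color := nth (0%N, true) cs d.

Definition points (cs : seq color) : seq point :=
  [seq (d, j) | d <- iota 0 (size cs), j <- iota 0 (col cs d).1.*2].

Definition discs c (T : tangle c) : seq color := c :: inner T.

(* The next point around the disc.  Going around in the same sense on the sphere,
   the outer disc, seen from its outside, is traversed in decreasing order. *)
Definition turn (cs : seq color) (u : point) : point :=
  let m := (col cs u.1).1.*2 in
  (u.1, if u.1 == 0%N then (u.2 + m.-1) %% m else u.2.+1 %% m)%N.

(* The shading of the region to the left of the string at u, for a traveller who
   runs along the string away from the disc of u. *)
Definition shade (cs : seq color) (u : point) : bool :=
  (col cs u.1).2 (+) odd u.2 (+) (u.1 == 0%N).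

(* string is an involution compatible with the shading, hence without fixed
   point, and every connected component has genus 0 (Euler's formula
   V - E + F = 2 C, discs without boundary points being left out).  The last
   condition concerns pictures with no string at all, which have only one
   region. *)
Definition planar c (T : tangle c) : bool :=
  let cs := discs T in
  let ps := points cs in
  [&& all (fun u => [&& string T u \in ps, string T (string T u) == u
                      & shade cs (string T u) != shade cs u]) ps,
      (count (fun c' : color => 0 < c'.1) cs
         + size (components ps (fun u => [:: turn cs (string T u)]))
       == (size ps)./2
         + (size (components ps (fun u => [:: string T u; turn cs u]))).*2)%N
    & ((ps == [::]) && (loops T == 0%N)) ==>
        all (fun c' : color => c'.2 == c.2) (inner T)].

(* The involution exchanging the two entries of each pair of l. *)
Definition pairing (l : seq (point * point)) (u : point) : point :=
  head u [seq (if q.1 == u then q.2 else q.1) | q <- l & (q.1 == u) || (q.2 == u)].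

(* glue T i S is T with its i-th inner disc (i = 0, 1, ...; this is the disc
   number i.+1) replaced by S.  Its inner discs are those of T before the i-th,
   those of S, and those of T after the i-th.  On the disjoint union of the
   boundary points of T (inl) and of S (inr), the strings of T, those of S, and
   the identifications of the points of the glued disc with the outer points of S
   form a graph made of paths, which are the strings of the result, and cycles,
   which are its new loops. *)
Section Glue.
Variables (c : color) (T : tangle c) (i : nat) (c' : color) (S : tangle c').

Definition glue_inner : seq color :=
  take i (inner T) ++ inner S ++ drop i.+1 (inner T).

Definition glue_nb (w : point + point) : seq (point + point) :=
  match w with
  | inl u => inl (string T u) ::
               (if u.1 == i.+1 then [:: inr (0%N, u.2)] else [::])
  | inr u => inr (string S u) ::
               (if u.1 == 0%N then [:: inl (i.+1, u.2)] else [::])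
  end.

Definition glue_vertices : seq (point + point) :=
  map inl (points (discs T)) ++ map inr (points (discs S)).

Definition glue_emb (u : point) : point + point :=
  let m := size (inner S) in
  if (u.1 <= i)%N then inl u
  else if (u.1 <= i + m)%N then inr ((u.1 - i)%N, u.2)
  else inl ((u.1.+1 - m)%N, u.2).

Definition glue_end (u : point) : point :=
  let r := reach glue_vertices glue_nb (glue_emb u) in
  head u [seq v <- points (c :: glue_inner) | (v != u) && (glue_emb v \in r)].

Definition glue_loops : nat :=
  let bd := map glue_emb (points (c :: glue_inner)) in
  (loops T + loops S
   + count (fun K => ~~ has (mem bd) K) (components glue_vertices glue_nb))%N.

Definition glue : tangle c := Tangle c glue_inner
    (pairing [seq (u, glue_end u) | u <- points (c :: glue_inner)]) glue_loops.
End Glue.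

(* The mirror image of a tangle (and of each of its discs) in a horizontal line. *)
Definition reflect cs (u : point) : point :=
  (u.1, ((col cs u.1).1.*2.-1 - u.2)%N).

Definition tangle_star c (T : tangle c) : tangle c :=
  let r := reflect (discs T) in
  Tangle c (inner T) (fun u => r (string T (r u))) (loops T).

Definition relabel (f : nat -> nat) (u : point) : point :=
  (if u.1 is e.+1 then (f e).+1 else 0%N, u.2).

Definition drawing c (cs : seq color) (l : seq (point * point)) : tangle c :=
  Tangle c cs (pairing l) 0.

Definition id_tangle (c : color) : tangle c :=
  drawing c [:: c] [seq ((0, j), (1, j))%N | j <- iota 0 c.1.*2].

Definition vacuum_tangle (s : bool) : tangle (0%N, s) := drawing _ [::] [::].

(* k through strands *)
Definition one_tangle (c : color) : tangle c :=
  drawing c [::] [seq ((0, j), (0, c.1.*2.-1 - j))%N | j <- iota 0 c.1].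

(* The disc 1 on top of the disc 2. *)
Definition mul_tangle (c : color) : tangle c :=
  let k := c.1 in
  drawing c [:: c; c]
    ([seq ((0, j), (1, j))%N | j <- iota 0 k]
     ++ [seq ((1, k.*2.-1 - j), (2, j))%N | j <- iota 0 k]
     ++ [seq ((2, k + j), (0, k + j))%N | j <- iota 0 k]).

Definition trace_tangle (c : color) : tangle (0%N, c.2) :=
  drawing _ [:: c] [seq ((1, j), (1, c.1.*2.-1 - j))%N | j <- iota 0 c.1].

(* ------------------------------------------------------------------------ *)
(* Subfactor planar algebras.  Z T xs is the action of T on the inputs xs, each
   packed with its colour; it is meaningful when T is planar and the colours of
   xs are those of the inner discs of T. *)
Definition fits (V : color -> Type) c (T : tangle c) (xs : seq {c & V c}) : bool :=
  planar T && (map (@projT1 _ _) xs == inner T).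

Record subfactor_planar_algebra (R : realType) := SubfactorPlanarAlgebra {
  box : color -> vectType R[i];
  Z : forall c, tangle c -> seq {c & box c} -> box c;
  adj : forall c, box c -> box c;
  delta : R[i];

  (* The action of tangles: isotopy and renumbering invariance, identity,
     multilinearity, composition. *)
  Z_relabel : forall c (T T' : tangle c) xs xs' (f : nat -> nat),
    fits T xs -> fits T' xs' -> loops T = loops T' ->
    perm_eq (map f (iota 0 (size xs))) (iota 0 (size xs')) ->
    (forall e, (e < size xs)%N -> onth xs' (f e) = onth xs e) ->
    {in points (discs T), forall u,
       string T' (relabel f u) = relabel f (string T u)} ->
    Z T xs = Z T' xs';
  Z_id : forall c (x : box c), Z (id_tangle c) [:: existT _ c x] = x;
  Z_linear : forall c (T : tangle c) xs1 xs2 c' (x y : box c') (a : R[i]),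
    fits T (xs1 ++ existT _ c' x :: xs2) ->
    Z T (xs1 ++ existT _ c' (a *: x + y) :: xs2) =
      a *: Z T (xs1 ++ existT _ c' x :: xs2)
      + Z T (xs1 ++ existT _ c' y :: xs2);
  Z_glue : forall c (T : tangle c) xs1 xs2 c' (S : tangle c') ys,
    fits S ys -> fits T (xs1 ++ existT _ c' (Z S ys) :: xs2) ->
    Z T (xs1 ++ existT _ c' (Z S ys) :: xs2) =
      Z (glue T (size xs1) S) (xs1 ++ ys ++ xs2);

  (* A closed loop is worth delta. *)
  delta_gt0 : 0 < delta;
  Z_loop : forall c (T : tangle c) xs, fits T xs ->
    Z (Tangle c (inner T) (string T) (loops T).+1) xs = delta *: Z T xs;

  (* the *-structure *)
  adj_semilinear : forall c (a : R[i]) (x y : box c),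
    adj (a *: x + y) = a^* *: adj x + adj y;
  adjK : forall c (x : box c), adj (adj x) = x;
  Z_adj : forall c (T : tangle c) xs, fits T xs ->
    adj (Z T xs) =
      Z (tangle_star T) [seq existT _ (projT1 b) (adj (projT2 b)) | b <- xs];

  (* One-dimensional 0-box spaces; the inner product tr (x^* x), a multiple of
     the empty picture, is positive definite. *)
  dim_box0 : forall s, \dim {: box (0%N, s)} = 1%N;
  Z_pos : forall c (x : box c), x != 0 -> exists2 a : R[i], 0 < a &
    Z (trace_tangle c) [:: existT _ c
       (Z (mul_tangle c) [:: existT _ c (adj x); existT _ c x])] =
      a *: Z (vacuum_tangle c.2) [::]
}.

Section PlanarAlgebra.
Variables (R : realType) (P : subfactor_planar_algebra R).

Definition irreducible : Prop := \dim {: box P (1%N, true)} = 1%N.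

Local Notation P2 := (box P (2%N, true)).
Local Notation P3 := (box P (3%N, true)).
Local Notation act T := (@Z R P _ T [::]).
Local Notation act1 T x := (@Z R P _ T [:: existT _ (2%N, true) x]).
Local Notation act2 T x y :=
  (@Z R P _ T [:: existT _ (2%N, true) x; existT _ (2%N, true) y]).

Definition mul k (x y : box P (k, true)) : box P (k, true) :=
  Z (mul_tangle (k, true)) [:: existT _ (k, true) x; existT _ (k, true) y].

Definition strand : box P (1%N, true) := act (one_tangle (1%N, true)).

Definition cupcap : P2 :=
  act (drawing (2, true) [::] [:: ((0, 0), (0, 1)); ((0, 2), (0, 3))])%N.

Definition jones_projection : P2 := (delta P)^-1 *: cupcap.

(* x to the left of y *)
Definition conv (x y : P2) : P2 :=
  act2 (drawing (2, true) [:: (2, true); (2, true)]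
    [:: ((0, 0), (1, 0)); ((1, 1), (2, 0)); ((2, 1), (0, 1));
        ((0, 3), (1, 3)); ((1, 2), (2, 3)); ((2, 2), (0, 2))])%N x y.

Definition rot180 (x : P2) : P2 :=
  act1 (drawing (2, true) [:: (2, true)]
    [:: ((0, 0), (1, 2)); ((0, 1), (1, 3));
        ((0, 2), (1, 0)); ((0, 3), (1, 1))])%N x.

(* closing the right strand *)
Definition close_right (x : P2) : box P (1%N, true) :=
  act1 (drawing (1, true) [:: (2, true)]
    [:: ((0, 0), (1, 0)); ((0, 1), (1, 3)); ((1, 1), (1, 2))])%N x.

(* x (x) 1 *)
Definition tens1 (x : P2) : P3 :=
  act1 (drawing (3, true) [:: (2, true)]
    [:: ((0, 0), (1, 0)); ((0, 1), (1, 1)); ((0, 2), (0, 3));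
        ((0, 4), (1, 2)); ((0, 5), (1, 3))])%N x.

(* 1 (x) F_s(x).  The 90 degree counterclockwise rotation takes the points
   1, 2, 3, 0 of x to the top left, top right, bottom right and bottom left. *)
Definition one_tensF (x : P2) : P3 :=
  act1 (drawing (3, true) [:: (2, true)]
    [:: ((0, 0), (0, 5)); ((0, 1), (1, 1)); ((0, 2), (1, 2));
        ((0, 3), (1, 3)); ((0, 4), (1, 0))])%N x.

Definition U3 : P3 :=
  act (drawing (3, true) [::]
    [:: ((0, 0), (0, 5)); ((0, 1), (0, 2)); ((0, 3), (0, 4))])%N.

Definition projection (q : P2) : Prop := mul q q = q /\ adj q = q.

(* q <= p iff p q = q *)
Definition minimal_projection (p : P2) : Prop :=
  [/\ projection p, p != 0
    & forall q, projection q -> mul p q = q -> q = 0 \/ q = p].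

Definition generated_by_2_boxes : Prop :=
  forall c (x : box P c),
  exists (m : nat) (a : 'I_m -> R[i]) (T : 'I_m -> tangle c)
         (xs : 'I_m -> seq {c' & box P c'}),
    (forall i, fits (T i) (xs i) /\
               all (fun b => (projT1 b).1 == 2%N) (xs i)) /\
    x = \sum_i a i *: Z (T i) (xs i).

Section Exchange.
Variables (n : nat) (p : 'I_n.+1 -> P2).

Definition E1 i j : P3 := mul (tens1 (p i)) (one_tensF (p j)).
Definition E2 s t : P3 := mul (mul (tens1 (p s)) U3) (tens1 (p t)).
Definition E3 l m : P3 := mul (one_tensF (p l)) (tens1 (p m)).

Definition exchange_relation : Prop :=
  generated_by_2_boxes /\
  forall i j, exists a b : 'I_n.+1 -> 'I_n.+1 -> R[i],
    E1 i j = \sum_s \sum_t a s t *: E2 s t + \sum_l \sum_m b l m *: E3 l m.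

(* N k j i is the coefficient N_{kj}^i *)
Definition fusion_coefficients (N : 'I_n.+1 -> 'I_n.+1 -> 'I_n.+1 -> R[i]) :=
  forall k j, conv (p k) (p j) = \sum_i N k j i *: p i.
End Exchange.
End PlanarAlgebra.

(* ------------------------------------------------------------------------ *)
(* fb_N j k s is \widetilde N_{j,k}^s; 0 <= z in R[i] means z real and >= 0. *)
Record fusion_bialgebra (R : realType) (n : nat) := FusionBialgebra {
  fb_alg : falgType R[i];
  fb_star : fb_alg -> fb_alg;
  fb_x : 'I_n.+1 -> fb_alg;
  fb_N : 'I_n.+1 -> 'I_n.+1 -> 'I_n.+1 -> R[i];
  fb_dual : 'I_n.+1 -> 'I_n.+1;
  fb_star_semilinear : forall (a : R[i]) x y,
    fb_star (a *: x + y) = a^* *: fb_star x + fb_star y;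
  fb_starM : forall x y, fb_star (x * y) = fb_star y * fb_star x;
  fb_starK : involutive fb_star;
  fb_basis : basis_of {: fb_alg} (codom fb_x);
  fb_x0 : fb_x ord0 = 1;
  fb_mul : forall j k, fb_x j * fb_x k = \sum_s fb_N j k s *: fb_x s;
  fb_N_ge0 : forall j k s, 0 <= fb_N j k s;
  fb_dualK : involutive fb_dual;
  fb_star_x : forall k, fb_star (fb_x k) = fb_x (fb_dual k);
  fb_N0 : forall j k, fb_N j k ord0 = (j == fb_dual k)%:R
}.

(* B is realized as the 2-box space of the irreducible subfactor planar algebra
   P, with minimal projections p_0, ..., p_n and quantum dimensions
   d_0, ..., d_n.  As p_0 is the Jones projection, d_0 = 1 / delta. *)
Definition realizes (R : realType) (n : nat) (B : fusion_bialgebra R n)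
    (P : subfactor_planar_algebra R) (p : 'I_n.+1 -> box P (2%N, true))
    (d : 'I_n.+1 -> R[i]) : Prop :=
  [/\ irreducible P /\ (forall x y : box P (2%N, true), mul x y = mul y x),
      injective p /\ (forall q, minimal_projection q <-> exists i, q = p i),
      p ord0 = jones_projection P,
      forall i, close_right (p i) = d i *: strand P
    & exists phi : {linear fb_alg B -> box P (2%N, true)},
        [/\ bijective phi,
            forall a b, phi (a * b) = conv (phi a) (phi b),
            forall j, phi (fb_x B j) = sqrtC (delta P / d j) *: p j
          & forall k, phi (fb_star (fb_x B k)) = rot180 (phi (fb_x B k))]].

(* ------------------------------------------------------------------------ *)
(* Fusion graphs: G k i j says that Gamma_k has an edge between white i and
   black j. *)
Definition fusion_graph_family (n : nat) := 'I_n.+1 -> 'I_n.+1 -> 'I_n.+1 -> bool.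

Definition is_fusion_graph (R : realType) (n : nat)
    (N : 'I_n.+1 -> 'I_n.+1 -> 'I_n.+1 -> R[i]) (G : fusion_graph_family n) : Prop :=
  forall k i j, G k i j = (N k j i != 0).

(* White vertices are on the left of the sum, black ones on the right. *)
Definition bipartite_rel (n : nat) (E : rel 'I_n.+1) : rel ('I_n.+1 + 'I_n.+1) :=
  fun u v => match u, v with
             | inl i, inr j => E i j
             | inr j, inl i => E i j
             | _, _ => false
             end.

(* A cyclic sequence of two adjacent vertices traverses an edge back and forth;
   the graph is acyclic when there are no longer simple cycles. *)
Definition acyclic (T : eqType) (e : rel T) : Prop :=
  forall s : seq T, ucycle e s -> (size s <= 2)%N.

Definition forest (n : nat) (G : fusion_graph_family n) : Prop :=
  forall k, acyclic (bipartite_rel (G k)).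

(* Main.v *)
Require Import Defs.
From HB Require Import structures.
From mathcomp Require Import all_boot all_order all_algebra all_field.
From mathcomp Require Import complex reals.
From mathcomp Require Import ring.

Set Implicit Arguments.
Unset Strict Implicit.
Unset Printing Implicit Defensive.
Import Order.TTheory GRing.Theory Num.Theory.
Local Open Scope ring_scope.

(** Fix k and let the edge of Gamma_k joining white i to black j carry the
    weight w(i, j) = N_{kj}^i d_i / d_k.  The unit of the 2-box space is the sum
    of the p_j, and convolving it with p_k amounts to closing the right strand of
    p_k; hence sum_j N_{kj}^i = d_k, so that the weights at white i add up to d_i
    (edge_weight_white).  Frobenius reciprocity turns this into the same fact for
    the black vertices: the weights at black j add up to d_j (edge_weight_black).

    On a forest, edge weights are determined by their vertex sums.  Removing the
    edge (i, j) separates i from j, and the alternating sum of the vertex sums over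
    the component of i leaves only w(i, j): every other edge has both its ends in
    the component or none, and one end of each colour (forest_edge_weight).  Thus
    w(i, j) is the sum of the d_s over the white s on the side of i, minus the sum
    of the d_s over the black s on that side.  An index s seen on both sides of the
    bipartition cancels, so each coefficient is -1, 0 or 1, and it depends only on
    Gamma_k and the edge.

    Finally N_{ij}^k is itself such a weight: by Frobenius reciprocity it is the
    weight of the edge of Gamma_k joining white i to black j* (edge_weight_dual),
    and the graph determines j* as the only black neighbour of white 0 in Gamma_j.
    If that edge is absent, N_{ij}^k = 0.

    The identities between concrete tangles behind these facts (unit, associativity
    and adjoint of the product, convolution with the unit) are decided by
    evaluating the combinatorial encoding of tangles. *)

(** * Edge weights on a forest *)

Section ForestWeights.
Variables (n : nat) (E : rel 'I_n.+1).

Definition remove_edge (i0 j0 : 'I_n.+1) : rel 'I_n.+1 :=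
  fun i j => E i j && ((i, j) != (i0, j0)).

Definition white_side (i0 j0 : 'I_n.+1) : pred ('I_n.+1 + 'I_n.+1) :=
  connect (bipartite_rel (remove_edge i0 j0)) (inl i0).

Definition edge_sign (i0 j0 s : 'I_n.+1) : int :=
  (white_side i0 j0 (inl s) : nat)%:Z - (white_side i0 j0 (inr s) : nat)%:Z.

Lemma edge_sign_values i0 j0 s :
  [\/ edge_sign i0 j0 s = -1, edge_sign i0 j0 s = 0 | edge_sign i0 j0 s = 1].
Proof.
rewrite /edge_sign; case: white_side; case: white_side.
- by constructor 2.
- by constructor 3.
- by constructor 1.
- by constructor 2.
Qed.

(** A path avoiding the edge and joining its ends closes up, with that edge,
    to a simple cycle of length at least three. *)
Lemma black_end_notin_white_side i0 j0 :
  acyclic (bipartite_rel E) -> E i0 j0 -> ~~ white_side i0 j0 (inr j0).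
Proof.
move=> acE Eij; apply/negP => /connectP[p0 path0].
case/shortenP: path0 => p path_p uniq_p _ last_p.
have sub : subrel (bipartite_rel (remove_edge i0 j0)) (bipartite_rel E).
  by move=> [i|i] [j|j] //= /andP[].
have cyc : ucycle (bipartite_rel E) (inl i0 :: p).
  by apply/andP; split=> //=; rewrite rcons_path (sub_path sub) //= -last_p.
have := acE _ cyc.
case: p path_p last_p {uniq_p cyc} => [|v [|v' p]] //= /andP[+ _] last_p _.
by rewrite -last_p /= /remove_edge eqxx andbF.
Qed.

(** Summing the vertex conditions over the white side of the edge, with the
    sign of the colour, every edge inside that side is counted once with each
    sign, and the edge (i0, j0) is the only one with just one end there.  A
    white and a black vertex with the same index carry the same d, which is why
    edge_sign is the difference of two indicators. *)
Lemma forest_edge_weight (F : pzRingType) (w : 'I_n.+1 -> 'I_n.+1 -> F)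
    (d : 'I_n.+1 -> F) i0 j0 :
  acyclic (bipartite_rel E) -> E i0 j0 ->
  (forall i j, ~~ E i j -> w i j = 0) ->
  (forall i, \sum_j w i j = d i) -> (forall j, \sum_i w i j = d j) ->
  w i0 j0 = \sum_s (edge_sign i0 j0 s)%:~R * d s.
Proof.
move=> acE Eij w0 sum_white sum_black.
pose A i : F := (white_side i0 j0 (inl i) : nat)%:R.
pose B j : F := (white_side i0 j0 (inr j) : nat)%:R.
transitivity (\sum_i \sum_j (A i - B j) * w i j).
  rewrite (bigD1 i0) //= (bigD1 j0) //= big1 => [|j ne_j]; last first.
    have [Ej|/w0->] := boolP (E i0 j); last by rewrite mulr0.
    suff -> : A i0 = B j by rewrite subrr mul0r.
    congr (_%:R); congr (nat_of_bool _); apply: same_connect_r.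
      by apply/sym_connect_sym=> -[x|x] [y|y].
    by apply/connect1; rewrite /= /remove_edge Ej xpair_eqE eqxx ne_j.
  rewrite big1 => [|i ne_i]; last first.
    rewrite big1 // => j _.
    have [Ej|/w0->] := boolP (E i j); last by rewrite mulr0.
    suff -> : A i = B j by rewrite subrr mul0r.
    congr (_%:R); congr (nat_of_bool _); apply: same_connect_r.
      by apply/sym_connect_sym=> -[x|x] [y|y].
    by apply/connect1; rewrite /= /remove_edge Ej xpair_eqE negb_and ne_i.
  rewrite /A /B (negPf (black_end_notin_white_side acE Eij)).
  by rewrite /white_side connect0 subr0 mul1r !addr0.
transitivity (\sum_i A i * d i - \sum_j B j * d j).
  under eq_bigr do (under eq_bigr do rewrite mulrBl; rewrite sumrB).
  rewrite sumrB; congr (_ - _).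
    by apply: eq_bigr => i _; rewrite -sum_white mulr_sumr.
  rewrite exchange_big; apply: eq_bigr => j _.
  by rewrite -sum_black mulr_sumr.
rewrite -sumrB; apply: eq_bigr => s _.
by rewrite /edge_sign intrB mulrBl.
Qed.
End ForestWeights.

(** * Tangle calculus *)

(** The string functions are compared on the boundary points only, so that this
    boolean, and with it the equality of the actions of two concrete tangles, can
    be computed. *)
Definition isotopic (f : nat -> nat) c (T T' : tangle c) : bool :=
  [&& planar T, planar T', loops T == loops T',
      perm_eq (map f (iota 0 (size (inner T)))) (iota 0 (size (inner T')))
    & all (fun u => string T' (relabel f u) == relabel f (string T u))
        (points (discs T))].

Definition conv_tangle : tangle (2%N, true) :=
  drawing (2, true) [:: (2, true); (2, true)]
    [:: ((0, 0), (1, 0)); ((1, 1), (2, 0)); ((2, 1), (0, 1));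
        ((0, 3), (1, 3)); ((1, 2), (2, 3)); ((2, 2), (0, 2))]%N.

Definition close_tangle : tangle (1%N, true) :=
  drawing (1, true) [:: (2, true)]
    [:: ((0, 0), (1, 0)); ((0, 1), (1, 3)); ((1, 1), (1, 2))]%N.

Definition add_strand_tangle : tangle (2%N, true) :=
  drawing (2, true) [:: (1, true)]
    [:: ((0, 0), (1, 0)); ((0, 3), (1, 1)); ((0, 1), (0, 2))]%N.

Section Calculus.
Variables (R : realType) (P : subfactor_planar_algebra R).

Lemma Z_isotopic f c (T T' : tangle c) (xs xs' : seq {c & box P c}) :
  isotopic f T T' ->
  map (@projT1 _ _) xs = inner T -> map (@projT1 _ _) xs' = inner T' ->
  (forall e, (e < size xs)%N -> onth xs' (f e) = onth xs e) ->
  Z T xs = Z T' xs'.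
Proof.
move=> /and5P[plT plT' /eqP eq_l perm_f /allP strs] colT colT' reorder.
apply: (Z_relabel _ _ eq_l (f := f)) => //.
- by rewrite /fits plT colT eqxx.
- by rewrite /fits plT' colT' eqxx.
- by rewrite -!(size_map (@projT1 _ _)) colT colT'.
- by move=> u /strs/eqP.
Qed.

Lemma Z_isotopic_id c (T T' : tangle c) (xs : seq {c & box P c}) :
  isotopic id T T' ->
  map (@projT1 _ _) xs = inner T -> map (@projT1 _ _) xs = inner T' ->
  Z T xs = Z T' xs.
Proof. by move=> iso colT colT'; apply: (Z_isotopic iso). Qed.

Lemma Z_sum c (T : tangle c) xs1 xs2 c' (I : finType) (a : I -> R[i])
    (x : I -> box P c') :
  (forall y, fits T (xs1 ++ existT _ c' y :: xs2)) ->
  Z T (xs1 ++ existT _ c' (\sum_i a i *: x i) :: xs2) =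
  \sum_i a i *: Z T (xs1 ++ existT _ c' (x i) :: xs2).
Proof.
move=> fitT.
pose f (y : box P c') : box P c := Z T (xs1 ++ existT _ c' y :: xs2).
have f_lin b (y z : box P c') : f (b *: y + z) = b *: f y + f z.
  by apply: Z_linear; apply: fitT.
have f0 : f 0 = 0.
  (* the empty sum: f 0 = f 0 + f 0 *)
  have := f_lin 1 0 0; rewrite !scale1r addr0 => /eqP.
  by rewrite -subr_eq subrr eq_sym => /eqP.
change (f (\sum_i a i *: x i) = \sum_i a i *: f (x i)).
by elim/big_rec2: _ => [|i y1 y2 _ <-]; [exact: f0 | exact: f_lin].
Qed.

(** Composition followed by an isotopy; every hypothesis is closed by
    computation when the tangles are concrete. *)
Lemma Z_fuse c (T T' : tangle c) c' (S : tangle c') xs1 ys xs2 :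
  planar T -> planar S -> isotopic id (glue T (size xs1) S) T' ->
  map (@projT1 _ (box P)) ys = inner S ->
  map (@projT1 _ (box P)) xs1 ++ c' :: map (@projT1 _ (box P)) xs2 = inner T ->
  map (@projT1 _ (box P)) (xs1 ++ ys ++ xs2) = inner T' ->
  Z T (xs1 ++ existT (box P) c' (Z S ys) :: xs2) = Z T' (xs1 ++ ys ++ xs2).
Proof.
move=> plT plS iso colS colT colT'; rewrite Z_glue; first last.
- by rewrite /fits plT map_cat /= colT eqxx.
- by rewrite /fits plS colS eqxx.
apply: Z_isotopic_id => //=; rewrite /glue_inner -colT -colS !map_cat.
rewrite -(size_map (@projT1 _ (box P)) xs1) take_size_cat //.
by rewrite -cat_rcons drop_size_cat // size_rcons.
Qed.

Local Notation P2 := (box P (2%N, true)).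
Local Notation input x := (existT (box P) _ x).

Definition one2 : P2 := Z (one_tangle (2%N, true)) [::].

(** Convolving with the unit on the right closes the right strand and adds a
    through strand. *)
Lemma conv_one (x : P2) a :
  close_right x = a *: strand P -> conv x one2 = a *: one2.
Proof.
move=> close_x.
have conv_close : conv x one2 = Z add_strand_tangle [:: input (close_right x)].
  pose T := glue add_strand_tangle 0 close_tangle.
  transitivity (Z T [:: input x]).
    by apply: (@Z_fuse _ conv_tangle T _ (one_tangle (2%N, true))
                 [:: input x] [::] [::]); vm_compute.
  symmetry.
  by apply: (@Z_fuse _ add_strand_tangle T _ close_tangle
               [::] [:: input x] [::]); vm_compute.
have add_one : Z add_strand_tangle [:: input (strand P)] = one2.
  by apply: (@Z_fuse _ add_strand_tangle (one_tangle (2%N, true)) _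
               (one_tangle (1%N, true)) [::] [::] [::]); vm_compute.
have pl_add : planar add_strand_tangle by vm_compute.
have := @Z_sum _ add_strand_tangle [::] [::] _ 'I_1
  (fun=> a) (fun=> strand P).
rewrite !big_ord1 conv_close close_x -add_one; apply.
by move=> y; rewrite /fits pl_add.
Qed.

Local Notation mul2 x y := (@Defs.mul R P 2 x y).

Lemma mul_one2 (x : P2) : mul2 x one2 = x.
Proof.
rewrite -[RHS]Z_id.
by apply: (@Z_fuse _ (mul_tangle _) (id_tangle _) _ (one_tangle (2%N, true))
             [:: input x] [::] [::]); vm_compute.
Qed.

Lemma mul2A (x y z : P2) : mul2 x (mul2 y z) = mul2 (mul2 x y) z.
Proof.
pose M := mul_tangle (2%N, true); pose T := glue M 1 M.
transitivity (Z T [:: input x; input y; input z]).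
  by apply: (@Z_fuse _ M T _ M [:: input x] [:: input y; input z] [::]); vm_compute.
symmetry.
by apply: (@Z_fuse _ M T _ M [::] [:: input x; input y] [:: input z]); vm_compute.
Qed.

Lemma mul2_sumr (I : finType) (a : I -> R[i]) (x : P2) (y : I -> P2) :
  mul2 x (\sum_i a i *: y i) = \sum_i a i *: mul2 x (y i).
Proof.
have pl_mul : planar (mul_tangle (2%N, true)) by vm_compute.
apply: (Z_sum (xs1 := [:: existT (box P) _ x]) (xs2 := [::])) => z.
by rewrite /fits pl_mul.
Qed.

Lemma adj_mul2 (x y : P2) : adj (mul2 x y) = mul2 (adj y) (adj x).
Proof.
have pl_mul : planar (mul_tangle (2%N, true)) by vm_compute.
rewrite /Defs.mul Z_adj; last by rewrite /fits pl_mul.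
(* the reflection puts the first disc below the second one *)
apply: (@Z_isotopic (fun e => 1 - e)%N); [by vm_compute | by [] | by [] |].
by case=> [|[|e]].
Qed.

(** * Minimal projections of an abelian 2-box space *)

Section MinimalProjections.
Variables (n : nat) (p : 'I_n.+1 -> P2).
Hypothesis mulC : forall x y : P2, mul2 x y = mul2 y x.
Hypothesis p_inj : injective p.
Hypothesis p_min : forall i, minimal_projection (p i).

(** The product of p i and p j is a projection below both, as they commute; by
    minimality it is zero unless they coincide. *)
Lemma mul_p i j : mul2 (p i) (p j) = if i == j then p i else 0.
Proof.
have [[pp_i adj_i] _ min_i] := p_min i.
have [<-|ne_ij] := eqVneq i j; first exact: pp_i.
have [[pp_j adj_j] _ min_j] := p_min j.
have absorb_i : mul2 (p i) (mul2 (p i) (p j)) = mul2 (p i) (p j).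
  by rewrite mul2A pp_i.
have absorb_j : mul2 (p j) (mul2 (p i) (p j)) = mul2 (p i) (p j).
  by rewrite mulC -mul2A pp_j.
have proj_ij : projection (mul2 (p i) (p j)).
  split; last by rewrite adj_mul2 adj_i adj_j mulC.
  by rewrite -[LHS]mul2A absorb_j absorb_i.
case: (min_i _ proj_ij absorb_i) => // eq_i.
case: (min_j _ proj_ij absorb_j) => // eq_j.
by case/eqP: ne_ij; apply: p_inj; rewrite -eq_i.
Qed.

(** Multiplying the unit by p i isolates its i-th coefficient, which is 1. *)
Lemma one2_sum_p c : one2 = \sum_i c i *: p i -> one2 = \sum_i p i.
Proof.
move=> eq_one; rewrite eq_one; apply: eq_bigr => i _.
have [_ p_neq0 _] := p_min i.
suff -> : c i = 1 by rewrite scale1r.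
apply/eqP; rewrite -subr_eq0.
have : (c i - 1) *: p i == 0.
  rewrite scalerBl scale1r -{2}[p i]mul_one2 eq_one mul2_sumr (bigD1 i) //=.
  rewrite mul_p eqxx big1 ?addr0 ?subrr // => j ne_j.
  by rewrite mul_p eq_sym (negPf ne_j) scaler0.
by rewrite scaler_eq0 (negPf p_neq0) orbF.
Qed.
End MinimalProjections.
End Calculus.

(** * Frobenius reciprocity *)

Section Frobenius.
Variables (R : realType) (n : nat) (B : fusion_bialgebra R n).

Local Notation Nt := (@fb_N R n B).
Local Notation x := (@fb_x R n B).
Local Notation dual := (@fb_dual R n B).

Lemma fb_x_inj (a b : 'I_n.+1 -> R[i]) :
  \sum_s a s *: x s = \sum_s b s *: x s -> a =1 b.
Proof.
move=> eq_ab s; pose X := codom_tuple x.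
have free_X : free X by apply: basis_free (fb_basis B).
suff coordX c : c s = coord X (enum_rank s) (\sum_s c s *: x s).
  by rewrite !coordX eq_ab.
rewrite (reindex (@enum_val 'I_n.+1 'I_n.+1)) /=; last exact/onW_bij/enum_val_bij.
rewrite -[c s](congr1 c (enum_rankK s)).
rewrite -(coord_sum_free (fun i => c (enum_val i)) _ free_X).
by congr (coord _ _ _); apply: eq_bigr => i _; rewrite nth_codom.
Qed.

Lemma fb_x_span (v : fb_alg B) :
  exists c : 'I_n.+1 -> R[i], v = \sum_s c s *: x s.
Proof.
pose X := codom_tuple x; exists (fun s => coord X (enum_rank s) v).
rewrite {1}(@coord_basis _ _ _ _ X v (fb_basis B) (memvf v)).
rewrite [RHS](reindex (@enum_val 'I_n.+1 'I_n.+1)) /=; last exact/onW_bij/enum_val_bij.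
by apply: eq_bigr => i _; rewrite enum_valK nth_codom.
Qed.

Lemma fb_x_neq0 j : x j != 0.
Proof.
apply/eqP => xj0.
have /fb_x_inj/(_ j)/eqP : \sum_s (s == j)%:R *: x s = \sum_s 0 *: x s.
  rewrite (bigD1 j) //= xj0 scaler0 add0r big1 => [|s /negPf->]; last first.
    by rewrite scale0r.
  by rewrite big1 // => s _; rewrite scale0r.
by rewrite eqxx oner_eq0.
Qed.

Lemma fb_N_assoc j k l s :
  \sum_t Nt j k t * Nt t l s = \sum_t Nt k l t * Nt j t s.
Proof.
have /fb_x_inj/(_ s) // : \sum_s (\sum_t Nt j k t * Nt t l s) *: x s
    = \sum_s (\sum_t Nt k l t * Nt j t s) *: x s.
transitivity (x j * x k * x l).
  rewrite fb_mul mulr_suml; under eq_bigr do rewrite scaler_suml.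
  rewrite exchange_big; apply: eq_bigr => t _.
  by rewrite -scalerAl fb_mul scaler_sumr; apply: eq_bigr => i _; rewrite scalerA.
rewrite -mulrA (fb_mul B k l) mulr_sumr.
under [RHS]eq_bigr do rewrite scaler_suml.
rewrite [RHS]exchange_big; apply: eq_bigr => t _.
by rewrite -scalerAr fb_mul scaler_sumr; apply: eq_bigr => i _; rewrite scalerA.
Qed.

(** The coefficient of the unit in the product of x j, x k and x (dual s),
    bracketed in the two ways. *)
Lemma fb_N_rot j k s : Nt j k s = Nt k (dual s) (dual j).
Proof.
have := fb_N_assoc j k (dual s) ord0.
rewrite (bigD1 s) //= fb_N0 fb_dualK eqxx mulr1 big1 ?addr0 => [->|t ne_ts].
  rewrite (bigD1 (dual j)) //= fb_N0 fb_dualK eqxx mulr1 big1 ?addr0 // => t ne_t.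
  rewrite fb_N0 [j == _]eq_sym (can2_eq (fb_dualK B) (fb_dualK B)).
  by rewrite (negPf ne_t) mulr0.
by rewrite fb_N0 fb_dualK (negPf ne_ts) mulr0.
Qed.

(** Compare the coefficients of the two sides of (x j x k)^* = x k^* x j^*; the
    conjugation disappears because the structure constants are nonnegative. *)
Lemma fb_N_star j k s : Nt j k s = Nt (dual k) (dual j) (dual s).
Proof.
have star0 : fb_star (0 : fb_alg B) = 0.
  have /eqP := fb_star_semilinear (1 : R[i]) (0 : fb_alg B) 0.
  by rewrite scaler0 addr0 conjC1 scale1r -subr_eq subrr eq_sym => /eqP.
have star_sum (c : 'I_n.+1 -> R[i]) (v : 'I_n.+1 -> fb_alg B) :
    fb_star (\sum_s c s *: v s) = \sum_s (c s)^* *: fb_star (v s).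
  elim/big_rec2: _ => [|i y1 y2 _ <-]; [exact: star0|exact: fb_star_semilinear].
have := fb_starM (x j) (x k).
rewrite fb_mul star_sum !fb_star_x fb_mul.
rewrite [RHS](reindex_inj (inv_inj (@fb_dualK _ _ B))) /= => eq_jk.
suff /fb_x_inj/(_ (dual s)) : \sum_s Nt j k (dual s) *: x s =
    \sum_s Nt (dual k) (dual j) s *: x s by rewrite fb_dualK.
rewrite (reindex_inj (inv_inj (@fb_dualK _ _ B))).
rewrite [RHS](reindex_inj (inv_inj (@fb_dualK _ _ B))) /= -eq_jk.
apply: eq_bigr => t _.
by rewrite fb_star_x fb_dualK geC0_conj // fb_N_ge0.
Qed.

Lemma fb_N_swap j k s : Nt j k s = Nt s (dual k) j.
Proof. by rewrite fb_N_rot fb_N_star !fb_dualK. Qed.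
End Frobenius.

(** * Fusion coefficients of a realized fusion bialgebra *)

Section Realization.
Variables (R : realType) (n : nat) (B : fusion_bialgebra R n).
Variables (P : subfactor_planar_algebra R) (p : 'I_n.+1 -> box P (2%N, true)).
Variables (d : 'I_n.+1 -> R[i]) (N : 'I_n.+1 -> 'I_n.+1 -> 'I_n.+1 -> R[i]).
Hypothesis realB : realizes B p d.
Hypothesis fusionN : fusion_coefficients p N.

Local Notation Nt := (@fb_N R n B).
Local Notation x := (@fb_x R n B).
Local Notation dual := (@fb_dual R n B).

Let a j := sqrtC (delta P / d j).

(** phi (x j) = a j p j is nonzero, which in turn excludes d j = 0. *)
Let a_neq0 j : a j != 0.
Proof.
have [_ _ _ _ [phi [phi_bij _ phi_x _]]] := realB.
apply/eqP=> aj0; have /eqP := phi_x j.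
rewrite -/(a j) aj0 scale0r => /eqP; rewrite -[RHS](raddf0 phi).
by move/(bij_inj phi_bij)/eqP; rewrite (negPf (fb_x_neq0 B j)).
Qed.

Let delta_neq0 : delta P != 0.
Proof. by rewrite gt_eqF // delta_gt0. Qed.

Lemma qdim_neq0 j : d j != 0.
Proof.
apply: contraNneq (a_neq0 j) => dj0.
by rewrite /a dj0 invr0 mulr0 sqrtC0.
Qed.

Let d_of_a j : d j = delta P / a j ^+ 2.
Proof. by rewrite sqrtCK invf_div mulrC divfK. Qed.

Lemma min_proj_free (b c : 'I_n.+1 -> R[i]) :
  \sum_s b s *: p s = \sum_s c s *: p s -> b =1 c.
Proof.
have [_ _ _ _ [phi [phi_bij _ phi_x _]]] := realB.
have sum_p e : \sum_s e s *: p s = phi (\sum_s (e s / a s) *: x s).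
  rewrite linear_sum; apply: eq_bigr => s _.
  by rewrite linearZ /= phi_x scalerA divfK.
rewrite !sum_p => /(bij_inj phi_bij)/fb_x_inj eq_bc s.
by have /(congr1 ( *%R^~ (a s))) := eq_bc s; rewrite !divfK.
Qed.

Lemma fusion_coefficientE j k s : N j k s = Nt j k s * a s / (a j * a k).
Proof.
have [_ _ _ _ [phi [_ phi_M phi_x _]]] := realB.
suff /min_proj_free/(_ s) : \sum_s N j k s *: p s =
  \sum_s (Nt j k s * a s / (a j * a k)) *: p s by [].
have p_phi i : p i = phi ((a i)^-1 *: x i).
  by rewrite linearZ /= phi_x scalerA mulVf ?scale1r.
rewrite -fusionN !p_phi -phi_M -scalerAl -scalerAr fb_mul scalerA linearZ /=.
rewrite linear_sum scaler_sumr; apply: eq_bigr => t _.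
rewrite /= !linearZ /= phi_x -/(a t) !scalerA; congr (_ *: _).
by field; rewrite ?a_neq0.
Qed.

(** Closing the right strand turns p i into d i; in terms of convolution,
    this says that the unit of the 2-box space, the sum of the p j, is an
    eigenvector of the convolution by p i. *)
Lemma sum_fusion_coefficients i k : \sum_j N i j k = d i.
Proof.
have [[_ mulC] [p_inj p_min] _ close_p [phi [phi_bij phi_M phi_x _]]] := realB.
have min_p j : minimal_projection (p j) by apply/p_min; exists j.
have one_p : one2 P = \sum_j p j.
  have [g _ gK] := phi_bij; have [c eq_c] := fb_x_span (g (one2 P)).
  apply: (one2_sum_p mulC p_inj min_p (c := fun s => c s * a s)).
  rewrite -[LHS]gK eq_c linear_sum; apply: eq_bigr => s _.
  by rewrite linearZ /= phi_x scalerA.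
have conv_sum : conv (p i) (\sum_j p j) = \sum_j conv (p i) (p j).
  have [g _ gK] := phi_bij.
  rewrite -[p i]gK; under eq_bigr do rewrite -[p _]gK.
  rewrite -linear_sum -phi_M mulr_sumr linear_sum.
  by apply: eq_bigr => j _; rewrite phi_M !gK.
have := conv_one (close_p i); rewrite one_p conv_sum => eq_i.
suff /min_proj_free/(_ k) :
  \sum_k (\sum_j N i j k) *: p k = \sum_k d i *: p k by [].
rewrite -scaler_sumr -eq_i; under [RHS]eq_bigr do rewrite fusionN.
by rewrite exchange_big; apply: eq_bigr => s _; rewrite scaler_suml.
Qed.

(** Only p (dual k) contributes to the component of p k * 1 on p ord0, so d k is
    an expression symmetric in k and dual k. *)
Lemma qdim_dual k : d (dual k) = d k.
Proof.
have d_a j : d j = a ord0 / (a j * a (dual j)).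
  rewrite -(sum_fusion_coefficients j ord0) (bigD1 (dual j)) //= big1.
    by rewrite addr0 fusion_coefficientE fb_N0 fb_dualK eqxx mul1r.
  move=> l ne_l; rewrite fusion_coefficientE fb_N0; case: eqP => [eq_j|_].
    by rewrite eq_j fb_dualK eqxx in ne_l.
  by rewrite !mul0r.
by rewrite (d_a (dual k)) (d_a k) fb_dualK [a k * _]mulrC.
Qed.

Let a_dual k : a (dual k) = a k.
Proof. by rewrite /a qdim_dual. Qed.

Lemma fusion_swap j k s : N j k s * d s = N s (dual k) j * d j.
Proof.
rewrite !fusion_coefficientE fb_N_swap !d_of_a a_dual.
by field; rewrite ?a_neq0.
Qed.

Lemma fusion_rot j k s : N j k s * d s = N k (dual s) (dual j) * d j.
Proof.
rewrite !fusion_coefficientE fb_N_rot !d_of_a !a_dual.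
by field; rewrite ?a_neq0.
Qed.

(** The normalization making the vertex sums at white i and at black i the same
    number d i. *)
Definition edge_weight k i j : R[i] := N k j i * d i / d k.

Lemma edge_weight_white k i : \sum_j edge_weight k i j = d i.
Proof.
rewrite -!mulr_suml sum_fusion_coefficients mulrAC mulfV ?mul1r //.
exact: qdim_neq0.
Qed.

Lemma edge_weight_black k j : \sum_i edge_weight k i j = d j.
Proof.
rewrite /edge_weight; under eq_bigr do rewrite fusion_rot mulfK ?qdim_neq0 //.
rewrite -(sum_fusion_coefficients j (dual k)).
by rewrite [RHS](reindex_inj (inv_inj (@fb_dualK _ _ B))).
Qed.

Lemma edge_weight_dual i j k : edge_weight k i (dual j) = N i j k.
Proof. by rewrite /edge_weight -fusion_swap mulfK // qdim_neq0. Qed.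

Lemma fusion_coefficient0_neq0 j k : (N j k ord0 != 0) = (k == dual j).
Proof.
rewrite fusion_coefficientE fb_N0 !mulf_eq0 invr_eq0 mulf_eq0.
rewrite !(negPf (a_neq0 _)) !orbF pnatr_eq0 eqb0 negbK.
by rewrite eq_sym (can2_eq (fb_dualK B) (fb_dualK B)).
Qed.
End Realization.

(** * Signs read off the fusion graph *)

Section Signs.
Variables (n : nat) (G : fusion_graph_family n).

(** N_{jj'}^0 is nonzero exactly when j' is the dual of j. *)
Definition graph_dual j : 'I_n.+1 := odflt ord0 [pick j' | G j ord0 j'].

Definition fusion_sign i j k s : int :=
  if G k i (graph_dual j) then edge_sign (G k) i (graph_dual j) s else 0.
End Signs.

Theorem theorem4p10 (R : realType) (n : nat) (G : fusion_graph_family n)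
    (forestG : forest G) :
  exists eps : 'I_n.+1 -> 'I_n.+1 -> 'I_n.+1 -> 'I_n.+1 -> int,
    (forall i j k s, [\/ eps i j k s = -1, eps i j k s = 0 | eps i j k s = 1]) /\
    forall (B : fusion_bialgebra R n) (P : subfactor_planar_algebra R)
           (p : 'I_n.+1 -> box P (2%N, true)) (d : 'I_n.+1 -> R[i])
           (N : 'I_n.+1 -> 'I_n.+1 -> 'I_n.+1 -> R[i]),
      realizes B p d ->
      exchange_relation p ->
      fusion_coefficients p N ->
      is_fusion_graph N G ->
      forall i j k, N i j k = \sum_s (eps i j k s)%:~R * d s.
Proof.
exists (fusion_sign G); split=> [i j k s|B P p d N realB _ fusionN graphG i j k].
  rewrite /fusion_sign; case: ifP => _; first exact: edge_sign_values.
  by constructor 2.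
have dualE : graph_dual G j = fb_dual B j.
  rewrite /graph_dual; case: pickP => [j'|/(_ (fb_dual B j))].
    by rewrite graphG (fusion_coefficient0_neq0 realB fusionN) => /eqP.
  by rewrite graphG (fusion_coefficient0_neq0 realB fusionN) eqxx.
rewrite -(edge_weight_dual realB fusionN) /fusion_sign dualE.
have [Gij|nGij] := boolP (G k i _); last first.
  rewrite big1 => [|s _]; last by rewrite mul0r.
  move: nGij; rewrite graphG negbK => /eqP N0.
  by rewrite /edge_weight N0 !mul0r.
apply: (forest_edge_weight (forestG k) Gij (w := edge_weight d N k)).
- move=> i' j'; rewrite graphG negbK => /eqP N0.
  by rewrite /edge_weight N0 !mul0r.
- exact: edge_weight_white realB fusionN k.
- exact: edge_weight_black realB fusionN k.
Qed.
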